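(* Let $A$ be a $d_1$-dimensional $k_1$-stochastic matrix of order $n$, let $B$ be a $d_2$-dimensional $k_2$-stochastic matrix of order $n$, and let $r=\max\{k_1+d_2,\,k_2+d_1\}$. If $r\le d_1+d_2-2$, then $n^{k_1+k_2-r-1}(AB)$ is a $(d_1+d_2-2)$-dimensional $r$-stochastic matrix of order $n$, where $AB$ is the dot product. Moreover, if $A$ and $B$ are polystochastic matrices with $d_1+d_2\ge 3$ (with no condition on $r$), then $AB$ is a polystochastic matrix.
   Context: Let $I_n^d = \{1,\ldots,n\}^d$ with $n,d$ positive integers. A $d$-dimensional matrix $A$ of order $n$ is an array $(a_\alpha)_{\alpha\in I_n^d}$ of real numbers. For $k\in\{0,\ldots,d\}$, a $k$-dimensional plane in $A$ is a submatrix obtained by fixing some $d-k$ components of the indices and letting the other $k$ components vary from $1$ to $n$. For $k\in\{0,\ldots,d\}$, $A$ is $k$-stochastic if all its entries are nonnegative and the sum of entries in each $k$-dimensional plane equals $1$. A $1$-stochastic matrix is called polystochastic. The dot product $AB$ of a $d_1$-dimensional matrix $A$ and a $d_2$-dimensional matrix $B$, both of order $n$, is the $(d_1+d_2-2)$-dimensional matrix $C$ of order $n$ with entries $c_{\alpha\beta}=\sum_{i=1}^n a_{\alpha i}\,b_{i\beta}$ for $\alpha\in I_n^{d_1-1}$, $\beta\in I_n^{d_2-1}$, where juxtaposition denotes concatenation of indices. *)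

(* Defs.v *)
From mathcomp Require Import all_boot all_order all_algebra.
From mathcomp Require Import reals.

Set Implicit Arguments.
Unset Strict Implicit.
Unset Printing Implicit Defensive.

Import Order.TTheory GRing.Theory Num.Theory.
Local Open Scope ring_scope.

Notation mindex n d := (d.-tuple 'I_n).

Definition mdmatrix (R : realType) (n d : nat) : Type := mindex n d -> R.

(* The plane through b whose components in S are fixed; its dimension is
   d - #|S|, and only the components of b in S matter. *)
Definition plane (n d : nat) (S : {set 'I_d}) (b : mindex n d) :
    {set mindex n d} :=
  [set a : mindex n d | [forall j in S, tnth a j == tnth b j]].

Definition kstochastic (R : realType) (n d k : nat) (A : mdmatrix R n d) : Prop :=
  [/\ (k <= d)%N,
      forall a : mindex n d, 0 <= A a
    & forall (S : {set 'I_d}) (b : mindex n d), #|S| = (d - k)%N ->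
        \sum_(a in plane S b) A a = 1].

Definition polystochastic (R : realType) (n d : nat) (A : mdmatrix R n d) : Prop :=
  kstochastic 1 A.

(* For d1, d2 > 0, an index g of length d1 + d2 - 2 is the concatenation of
   take d1.-1 g and drop d1.-1 g.  The sequences read by nth then have lengths
   exactly d1 and d2, so its default value i is never used: the comprehensions
   only retype them as tuples. *)
Definition dot_lindex (n d1 d2 : nat) (g : mindex n (d1 + d2 - 2)) (i : 'I_n) :
    mindex n d1 :=
  [tuple nth i (rcons (take d1.-1 g) i) j | j < d1].

Definition dot_rindex (n d1 d2 : nat) (g : mindex n (d1 + d2 - 2)) (i : 'I_n) :
    mindex n d2 :=
  [tuple nth i (i :: drop d1.-1 g) j | j < d2].

Definition dotmd (R : realType) (n d1 d2 : nat)
    (A : mdmatrix R n d1) (B : mdmatrix R n d2) : mdmatrix R n (d1 + d2 - 2) :=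
  fun g => \sum_(i < n) A (dot_lindex g i) * B (dot_rindex g i).

Definition scalemd (R : realType) (n d : nat) (c : R) (A : mdmatrix R n d) :
    mdmatrix R n d :=
  fun a => c * A a.

(* Main.v *)
Require Import Defs.
From mathcomp Require Import all_boot all_order all_algebra.
From mathcomp Require Import reals.
From mathcomp Require Import zify.

Set Implicit Arguments.
Unset Strict Implicit.
Unset Printing Implicit Defensive.

Import Order.TTheory GRing.Theory Num.Theory.
Local Open Scope ring_scope.

(** The sum of AB over a plane factors at each value of the contracted index:
    for fixed i, an index of AB is the same thing as a pair of an index of A
    ending in i and an index of B starting with i, and a plane of AB that
    fixes the components in S corresponds to a product of a plane of A and a
    plane of B, which fix the components coming from S and the contracted
    component (plane_sum_dotmd).

    A plane of dimension k + m splits into n ^ m parallel planes of dimension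
    k, so in a k-stochastic matrix its sum is n ^ m
    (kstochastic_plane_sum).  If S fixes s1 components of A and s2 of B, with
    s1 + s2 = d1 + d2 - 2 - r, then the definition of r makes the planes of A
    and B met above of dimension at least k1 and k2, and the sum over i is
    n * n ^ (d1 - s1 - 1 - k1) * n ^ (d2 - s2 - 1 - k2) = n ^ (1 + r - k1 - k2),
    which the scalar cancels.

    When A and B are polystochastic, a line of AB has its one free component
    on one side, say in B.  The factors from B are then sums over lines, equal
    to 1, and the remaining sum over i of entries of A is the sum of A
    over a line in the contracted direction, again 1. *)

(** * Sums over planes *)

Lemma in_planeP (n d : nat) (S : {set 'I_d}) (a b : mindex n d) :
  reflect {in S, forall j, tnth a j = tnth b j} (a \in plane S b).
Proof.
rewrite inE; apply: (iffP forall_inP) => [ab j jS|ab j jS].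
  by apply/eqP/ab.
by apply/eqP/ab.
Qed.

Lemma plane_refl (n d : nat) (S : {set 'I_d}) (b : mindex n d) :
  b \in plane S b.
Proof. by apply/in_planeP. Qed.

(** The base points c x are left arbitrary because two families are used:
    b with one component replaced, and the indices of A or B that share all
    but the contracted component. *)
Lemma plane_sum_slice (R : realType) (n d : nat) (A : mdmatrix R n d)
    (S : {set 'I_d}) (j : 'I_d) (b : mindex n d) (c : 'I_n -> mindex n d) :
    j \notin S -> (forall x, c x \in plane S b) ->
    (forall x, tnth (c x) j = x) ->
  \sum_(a in plane S b) A a = \sum_(x < n) \sum_(a in plane (j |: S) (c x)) A a.
Proof.
move=> jS cb cj; rewrite (partition_big (fun a => tnth a j) xpredT) //=.
apply: eq_bigr => x _; apply: eq_bigl => a; apply/andP/in_planeP.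
  case=> /in_planeP ab /eqP ax l; rewrite in_setU1 => /predU1P[->|lS].
    by rewrite cj.
  by rewrite ab //; have /in_planeP-> := cb x.
move=> ac; split; last by rewrite ac ?setU11 // cj.
apply/in_planeP => l lS; rewrite ac ?in_setU1 ?lS ?orbT //.
by have /in_planeP-> := cb x.
Qed.

(** Fixing one more component at a time, down to dimension k: each step
    replaces the sum by n sums over planes of one dimension less. *)
Lemma kstochastic_plane_sum (R : realType) (n d k : nat) (A : mdmatrix R n d)
    (S : {set 'I_d}) (b : mindex n d) :
    kstochastic k A -> (#|S| + k <= d)%N ->
  \sum_(a in plane S b) A a = n%:R ^+ (d - (#|S| + k)).
Proof.
case=> _ _ A1; move: {2}(d - _)%N (erefl (d - (#|S| + k)))%N => m.
elim: m S b => [|m IHm] S b Em leSd; first by rewrite Em A1 //; lia.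
have [j jS] : exists j, j \notin S.
  suff /set0Pn[j] : ~: S != set0 by rewrite inE; exists j.
  by rewrite -card_gt0 cardsCs setCK card_ord; lia.
pose c x : mindex n d := [tuple if l == j then x else tnth b l | l < d].
have cardjS : #|j |: S| = #|S|.+1 by rewrite cardsU1 jS.
rewrite (@plane_sum_slice _ _ _ _ _ j _ c) //; last first.
- by move=> x; rewrite tnth_mktuple eqxx.
- move=> x; apply/in_planeP => l lS; rewrite tnth_mktuple.
  by case: eqP => // lj; rewrite lj (negPf jS) in lS.
have Ejm : (d - (#|j |: S| + k) = m)%N by rewrite cardjS; lia.
rewrite (eq_bigr (fun=> n%:R ^+ m)) => [|x _]; last first.
  by rewrite IHm ?Ejm // cardjS; lia.
by rewrite sumr_const card_ord Em exprS mulr_natl.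
Qed.

(** * Planes of a dot product *)

Section DotPlanes.

Variables (n p q : nat).
Notation dotdim := (p.+1 + q.+1 - 2)%N.

Fact dotdimE : (p + q = dotdim)%N.
Proof. by lia. Qed.

Definition lpos (j : 'I_p) : 'I_dotdim := cast_ord dotdimE (lshift q j).
Definition rpos (j : 'I_q) : 'I_dotdim := cast_ord dotdimE (rshift p j).

Lemma dot_posP (s : 'I_dotdim) :
  (exists j, s = lpos j) \/ (exists j, s = rpos j).
Proof.
rewrite -[s](cast_ordKV dotdimE).
by case: (splitP (cast_ord (esym dotdimE) s)) => j Ej; [left|right];
  exists j; congr cast_ord; apply: val_inj.
Qed.

Lemma tnth_dot_lindex_max (g : mindex n dotdim) i :
  tnth (dot_lindex g i : mindex n p.+1) ord_max = i.
Proof.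
rewrite tnth_mktuple nth_rcons size_takel ?size_tuple; last by lia.
by rewrite /= ltnn eqxx.
Qed.

Lemma tnth_dot_lindex (g : mindex n dotdim) i j :
  tnth (dot_lindex g i : mindex n p.+1) (lift ord_max j) = tnth g (lpos j).
Proof.
rewrite tnth_mktuple nth_rcons size_takel ?size_tuple; last by lia.
by rewrite lift_max ltn_ord nth_take //= (tnth_nth i).
Qed.

Lemma tnth_dot_rindex0 (g : mindex n dotdim) i :
  tnth (dot_rindex g i : mindex n q.+1) ord0 = i.
Proof. by rewrite tnth_mktuple. Qed.

Lemma tnth_dot_rindex (g : mindex n dotdim) i j :
  tnth (dot_rindex g i : mindex n q.+1) (lift ord0 j) = tnth g (rpos j).
Proof. by rewrite tnth_mktuple lift0 /= nth_drop (tnth_nth i). Qed.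

Definition join_index (ab : mindex n p.+1 * mindex n q.+1) : mindex n dotdim :=
  [tuple match split (cast_ord (esym dotdimE) s) with
         | inl j => tnth ab.1 (lift ord_max j)
         | inr j => tnth ab.2 (lift ord0 j)
         end | s < dotdim].

Lemma tnth_join_lpos ab j :
  tnth (join_index ab) (lpos j) = tnth ab.1 (lift ord_max j).
Proof. by rewrite tnth_mktuple cast_ordK (unsplitK (inl j)). Qed.

Lemma tnth_join_rpos ab j :
  tnth (join_index ab) (rpos j) = tnth ab.2 (lift ord0 j).
Proof. by rewrite tnth_mktuple cast_ordK (unsplitK (inr j)). Qed.

Definition lfixed (S : {set 'I_dotdim}) : {set 'I_p.+1} :=
  lift ord_max @: [set j | lpos j \in S].

Definition rfixed (S : {set 'I_dotdim}) : {set 'I_q.+1} :=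
  lift ord0 @: [set j | rpos j \in S].

Lemma lfixed_max (S : {set 'I_dotdim}) : ord_max \notin lfixed S.
Proof. by apply/imsetP => -[j _ /eqP]; rewrite (negPf (neq_lift _ _)). Qed.

Lemma rfixed0 (S : {set 'I_dotdim}) : ord0 \notin rfixed S.
Proof. by apply/imsetP => -[j _ /eqP]; rewrite (negPf (neq_lift _ _)). Qed.

Lemma card_fixed (S : {set 'I_dotdim}) : (#|S| = #|lfixed S| + #|rfixed S|)%N.
Proof.
rewrite !card_imset; try exact: lift_inj.
rewrite -!sum1_card (reindex (cast_ord dotdimE)) /=; last first.
  by exists (cast_ord (esym dotdimE)) => s _; rewrite ?cast_ordK ?cast_ordKV.
rewrite big_mkcond big_split_ord /= -!big_mkcond.
by congr (_ + _)%N; apply: eq_bigl => j; rewrite inE.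
Qed.

Lemma card_lfixed (S : {set 'I_dotdim}) : (#|lfixed S| <= p)%N.
Proof.
rewrite card_imset; last exact: lift_inj.
by rewrite -[leqRHS]card_ord max_card.
Qed.

Lemma card_rfixed (S : {set 'I_dotdim}) : (#|rfixed S| <= q)%N.
Proof.
rewrite card_imset; last exact: lift_inj.
by rewrite -[leqRHS]card_ord max_card.
Qed.

Lemma dot_lindex_plane (S : {set 'I_dotdim}) (g h : mindex n dotdim) i k :
  h \in plane S g -> dot_lindex h i \in plane (lfixed S) (dot_lindex g k).
Proof.
move=> /in_planeP hg; apply/in_planeP => _ /imsetP[j jS ->].
by rewrite !tnth_dot_lindex hg //; rewrite inE in jS.
Qed.

Lemma dot_rindex_plane (S : {set 'I_dotdim}) (g h : mindex n dotdim) i k :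
  h \in plane S g -> dot_rindex h i \in plane (rfixed S) (dot_rindex g k).
Proof.
move=> /in_planeP hg; apply/in_planeP => _ /imsetP[j jS ->].
by rewrite !tnth_dot_rindex hg //; rewrite inE in jS.
Qed.

Lemma mem_dot_plane (S : {set 'I_dotdim}) (g h : mindex n dotdim) i :
  (h \in plane S g) =
  (dot_lindex h i \in plane (ord_max |: lfixed S) (dot_lindex g i)) &&
  (dot_rindex h i \in plane (ord0 |: rfixed S) (dot_rindex g i)).
Proof.
apply/idP/andP => [hg | [/in_planeP hgl /in_planeP hgr]].
  have /in_planeP hgl := dot_lindex_plane i i hg.
  have /in_planeP hgr := dot_rindex_plane i i hg.
  split; apply/in_planeP => j; rewrite in_setU1 => /predU1P[->|].
  - by rewrite !tnth_dot_lindex_max.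
  - exact: hgl.
  - by rewrite !tnth_dot_rindex0.
  - exact: hgr.
apply/in_planeP => s sS; have [[j sj]|[j sj]] := dot_posP s; rewrite sj in sS *.
  rewrite -!(tnth_dot_lindex _ i) hgl // in_setU1 orbC imset_f //.
  by rewrite inE.
rewrite -!(tnth_dot_rindex _ i) hgr // in_setU1 orbC imset_f //.
by rewrite inE.
Qed.

Lemma join_indexK (h : mindex n dotdim) i :
  join_index (dot_lindex h i, dot_rindex h i) = h.
Proof.
apply: eq_from_tnth => s; have [[j ->]|[j ->]] := dot_posP s.
  by rewrite tnth_join_lpos tnth_dot_lindex.
by rewrite tnth_join_rpos tnth_dot_rindex.
Qed.

Lemma dot_lindex_join ab i :
  tnth ab.1 ord_max = i -> dot_lindex (join_index ab) i = ab.1.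
Proof.
move=> abi; apply: eq_from_tnth => j; case: (unliftP ord_max j) => [l ->|->].
  by rewrite tnth_dot_lindex tnth_join_lpos.
by rewrite tnth_dot_lindex_max.
Qed.

Lemma dot_rindex_join ab i :
  tnth ab.2 ord0 = i -> dot_rindex (join_index ab) i = ab.2.
Proof.
move=> abi; apply: eq_from_tnth => j; case: (unliftP ord0 j) => [l ->|->].
  by rewrite tnth_dot_rindex tnth_join_rpos.
by rewrite tnth_dot_rindex0.
Qed.

Variables (R : realType) (A : mdmatrix R n p.+1) (B : mdmatrix R n q.+1).

(** For each i, splitting an index at the contraction is a bijection from the
    plane of AB onto the product of the two planes on the right. *)
Lemma plane_sum_dotmd (S : {set 'I_dotdim}) (g : mindex n dotdim) :
  \sum_(h in plane S g) dotmd A B h =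
  \sum_(i < n)
    (\sum_(a in plane (ord_max |: lfixed S) (dot_lindex g i)) A a) *
    (\sum_(b in plane (ord0 |: rfixed S) (dot_rindex g i)) B b).
Proof.
rewrite exchange_big; apply: eq_bigr => i _; rewrite big_distrlr /= pair_big /=.
rewrite (reindex_onto (fun h => (dot_lindex h i, dot_rindex h i)) join_index) /=.
  by apply: eq_bigl => h; rewrite join_indexK eqxx andbT -mem_dot_plane.
case=> a b /andP[/in_planeP ag /in_planeP bg].
rewrite dot_lindex_join ?dot_rindex_join //=.
  by rewrite bg ?setU11 // tnth_dot_rindex0.
by rewrite ag ?setU11 // tnth_dot_lindex_max.
Qed.

(** Letting the contracted index vary sweeps a plane of one more dimension.
    This evaluates the sum of a dot product when the planes of the other
    factor all have sum 1. *)
Lemma lfixed_slice (S : {set 'I_dotdim}) (g : mindex n dotdim) (k : 'I_n) :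
  \sum_(i < n) \sum_(a in plane (ord_max |: lfixed S) (dot_lindex g i)) A a =
  \sum_(a in plane (lfixed S) (dot_lindex g k)) A a.
Proof.
rewrite (@plane_sum_slice _ _ _ _ _ ord_max _ (dot_lindex g)) ?lfixed_max // => x.
  by rewrite dot_lindex_plane ?plane_refl.
by rewrite tnth_dot_lindex_max.
Qed.

Lemma rfixed_slice (S : {set 'I_dotdim}) (g : mindex n dotdim) (k : 'I_n) :
  \sum_(i < n) \sum_(b in plane (ord0 |: rfixed S) (dot_rindex g i)) B b =
  \sum_(b in plane (rfixed S) (dot_rindex g k)) B b.
Proof.
rewrite (@plane_sum_slice _ _ _ _ _ ord0 _ (dot_rindex g)) ?rfixed0 // => x.
  by rewrite dot_rindex_plane ?plane_refl.
by rewrite tnth_dot_rindex0.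
Qed.

End DotPlanes.

(** * Stochasticity of dot products *)

Lemma dotmd_ge0 (R : realType) (n d1 d2 : nat)
    (A : mdmatrix R n d1) (B : mdmatrix R n d2) g :
  (forall a, 0 <= A a) -> (forall b, 0 <= B b) -> 0 <= dotmd A B g.
Proof. by move=> A0 B0; apply: sumr_ge0 => i _; rewrite mulr_ge0. Qed.

Lemma kstochastic_dotmd (R : realType) (n p q k1 k2 : nat)
    (A : mdmatrix R n p.+1) (B : mdmatrix R n q.+1) :
    (0 < n)%N -> kstochastic k1 A -> kstochastic k2 B ->
    let r := maxn (k1 + q.+1) (k2 + p.+1) in (r <= p.+1 + q.+1 - 2)%N ->
  kstochastic r
    (scalemd ((n%:R : R) ^ (k1%:Z + k2%:Z - r%:Z - 1)) (dotmd A B)).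
Proof.
move=> n_gt0 stA stB r le_rd; have [_ A0 _] := stA; have [_ B0 _] := stB.
have n0 : (n%:R : R) != 0 by rewrite pnatr_eq0 -lt0n.
split=> // [g|S g cardS].
  by rewrite mulr_ge0 ?dotmd_ge0 // exprz_ge0 ?ler0n.
rewrite -mulr_sumr plane_sum_dotmd.
have := card_fixed S; set s1 := #|lfixed S|; set s2 := #|rfixed S| => Es.
have cA : #|ord_max |: lfixed S| = s1.+1 by rewrite cardsU1 lfixed_max.
have cB : #|ord0 |: rfixed S| = s2.+1 by rewrite cardsU1 rfixed0.
under eq_bigr => i _.
  rewrite (kstochastic_plane_sum _ stA) cA; last by lia.
  rewrite (kstochastic_plane_sum _ stB) cB; last by lia.
  over.
rewrite sumr_const card_ord -exprD -[X in _ * X]mulr_natl -exprS exprnP -expfzDr //.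
by rewrite [X in _ ^ X](_ : _ = 0) ?expr0z //; lia.
Qed.

Lemma polystochastic_dotmd (R : realType) (n p q : nat)
    (A : mdmatrix R n p.+1) (B : mdmatrix R n q.+1) :
    (0 < n)%N -> (3 <= p.+1 + q.+1)%N ->
  polystochastic A -> polystochastic B -> polystochastic (dotmd A B).
Proof.
case: n A B => // n A B _ d_ge3 stA stB.
have [_ A0 _] := stA; have [_ B0 _] := stB.
split=> [|g|S g cardS]; first by lia.
  by rewrite dotmd_ge0.
rewrite plane_sum_dotmd; have := card_fixed S.
have := card_lfixed S; have := card_rfixed S => les1 les2 Es.
have cA : #|ord_max |: lfixed S| = #|lfixed S|.+1 by rewrite cardsU1 lfixed_max.
have cB : #|ord0 |: rfixed S| = #|rfixed S|.+1 by rewrite cardsU1 rfixed0.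
have [sp | sp] := eqVneq #|lfixed S| p.
  (* Here A has no free component left, and the planes of B are lines. *)
  under eq_bigr => i _.
    rewrite (kstochastic_plane_sum _ stB) cB; last by lia.
    rewrite (_ : _ - _ = 0)%N ?mulr1; last by lia.
    over.
  rewrite (lfixed_slice _ _ _ ord0) (kstochastic_plane_sum _ stA) sp ?addn1 //.
  by rewrite subnn.
(* Symmetrically, the one free component is in A: its planes are lines, and
   the rest is a sum over a line of B in the contracted direction. *)
under eq_bigr => i _.
  rewrite (kstochastic_plane_sum _ stA) cA; last by lia.
  rewrite (_ : _ - _ = 0)%N ?mul1r; last by lia.
  over.
have sq : #|rfixed S| = q by lia.
rewrite (rfixed_slice _ _ _ ord0) (kstochastic_plane_sum _ stB) sq ?addn1 //.
by rewrite subnn.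
Qed.

Theorem theorem5 (R : realType) (n d1 d2 : nat)
    (n_gt0 : (0 < n)%N) (d1_gt0 : (0 < d1)%N) (d2_gt0 : (0 < d2)%N)
    (A : mdmatrix R n d1) (B : mdmatrix R n d2) :
  (forall k1 k2 : nat, kstochastic k1 A -> kstochastic k2 B ->
     let r := maxn (k1 + d2) (k2 + d1) in
     (r <= d1 + d2 - 2)%N ->
     kstochastic r
       (scalemd ((n%:R : R) ^ (k1%:Z + k2%:Z - r%:Z - 1)) (dotmd A B)))
  /\ (polystochastic A -> polystochastic B -> (3 <= d1 + d2)%N ->
      polystochastic (dotmd A B)).
Proof.
case: d1 d2 d1_gt0 d2_gt0 A B => [//|p] [//|q] _ _ A B.
split=> [k1 k2 stA stB|stA stB d_ge3]; first exact: kstochastic_dotmd.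
exact: polystochastic_dotmd.
Qed.
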